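(* Let $J\subseteq\{(i,j)\mid 1\le i<j\le n\}$ be closed and let $H\subseteq U_J$ be a subgroup. Then $$V=\{\phi\in J^*\mid x_\phi\in H\}$$ is an $\mathbb{F}_q$-vector space (i.e. a linear subspace of $J^*$) if and only if $H$ is a sub-algebra group of $U_J$.
   Context: Let $\mathbb{F}_q$ be the finite field with $q$ elements. A set $J\subseteq\{(i,j)\mid 1\le i<j\le n\}$ is closed if $(i,j),(j,k)\in J$ implies $(i,k)\in J$. $J^*$ is the $\mathbb{F}_q$-vector space of functions $\phi:J\to\mathbb{F}_q$. For $\phi\in J^*$, $X_\phi$ is the $n\times n$ matrix with $(i,j)$ entry $\phi(i,j)$ for $(i,j)\in J$ and all other entries $0$, and $x_\phi=1+X_\phi$. Let $\mathfrak{n}_J=\{X_\phi\mid\phi\in J^*\}$, a nilpotent $\mathbb{F}_q$-algebra, and $U_J=1+\mathfrak{n}_J$ the pattern group. A subgroup $H\subseteq U_J$ is a sub-algebra group if $H=1+\mathfrak{m}$ for some $\mathbb{F}_q$-subalgebra $\mathfrak{m}$ (not necessarily unital) of $\mathfrak{n}_J$. *)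

(* Defs.v *)
From HB Require Import structures.
From mathcomp Require Import all_boot all_order all_algebra all_fingroup.

Set Implicit Arguments.
Unset Strict Implicit.
Unset Printing Implicit Defensive.

Import GRing.Theory.
Local Open Scope ring_scope.

(* The index set {1, ..., n} is rendered as 'I_n, i.e. {0, ..., n - 1}. *)
Definition strictly_upper n (J : {set 'I_n * 'I_n}) : Prop :=
  forall i j : 'I_n, (i, j) \in J -> (i < j)%N.

Definition closed_pattern n (J : {set 'I_n * 'I_n}) : Prop :=
  forall i j k : 'I_n, (i, j) \in J -> (j, k) \in J -> (i, k) \in J.

(* The codomain is F^o, the field F regarded as a module over itself, so that
   J^* carries the pointwise F-vector space structure of the library. *)
Definition pattern_dual (F : finFieldType) n (J : {set 'I_n * 'I_n}) :=
  {ffun {p : 'I_n * 'I_n | p \in J} -> F^o}.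

Section PatternGroups.

(* {'GL_n.+1[F]} is a group of matrices of size n.+1, so the size is taken
   to be a successor throughout. *)
Variables (F : finFieldType) (n : nat) (J : {set 'I_n.+1 * 'I_n.+1}).

Definition pattern_mx (phi : pattern_dual F J) : 'M[F]_n.+1 :=
  \matrix_(i, j) if insub (i, j) is Some p then phi p else 0.

Definition pattern_unimx (phi : pattern_dual F J) : 'M[F]_n.+1 :=
  1 + pattern_mx phi.

Definition pattern_algebra : {set 'M[F]_n.+1} :=
  [set pattern_mx phi | phi : pattern_dual F J].

Definition pattern_group : {set {'GL_n.+1[F]}} :=
  [set g : {'GL_n.+1[F]} | GLval g \in [set 1 + X | X in pattern_algebra]].

(* m need not contain an identity element. *)
Definition subalgebra_of_pattern (m : {set 'M[F]_n.+1}) : Prop :=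
  [/\ m \subset pattern_algebra, submod_closed m & GRing.mulr_2closed m].

Definition subalgebra_group (H : {set {'GL_n.+1[F]}}) : Prop :=
  exists2 m : {set 'M[F]_n.+1}, subalgebra_of_pattern m &
    [set GLval g | g : {'GL_n.+1[F]} in H] = [set 1 + X | X in m].

Definition pattern_functions (H : {set {'GL_n.+1[F]}}) :
    {pred pattern_dual F J} :=
  [pred phi | pattern_unimx phi \in [set GLval g | g : {'GL_n.+1[F]} in H]].

End PatternGroups.

(* Main.v *)
Require Import Defs.
From HB Require Import structures.
From mathcomp Require Import all_boot all_order all_algebra all_fingroup.

Set Implicit Arguments.
Unset Strict Implicit.
Unset Printing Implicit Defensive.

Import GRing.Theory.
Local Open Scope ring_scope.

(** Let m = { X_phi | phi in V }, so that H = 1 + m as sets and V is linear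
    exactly when m is.  If m is linear, it is stable under products because
    (1 + X)(1 + Y) = 1 + (X + Y + XY) lies in H, so that X + Y + XY, and hence
    XY, lies in m. *)

Section PatternMatrices.

Variables (F : finFieldType) (n : nat) (J : {set 'I_n.+1 * 'I_n.+1}).
Implicit Types (phi psi : pattern_dual F J) (H : {group {'GL_n.+1[F]}}).

Lemma pattern_mx_is_linear a phi psi :
  pattern_mx (a *: phi + psi) = a *: pattern_mx phi + pattern_mx psi.
Proof.
apply/matrixP => i j; rewrite !mxE.
by case: insub => [p|]; rewrite ?ffunE ?mulr0 ?addr0.
Qed.

Lemma pattern_mx0 : pattern_mx (0 : pattern_dual F J) = 0.
Proof.
by apply/matrixP => i j; rewrite !mxE; case: insub => // p; rewrite ffunE.
Qed.

Lemma pattern_functionsP H phi :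
  reflect (exists2 g, g \in H & 1 + pattern_mx phi = GLval g)
          (phi \in pattern_functions (J := J) H).
Proof. exact: imsetP. Qed.

(** Membership in [pattern_group] supplies [phi], and [g] itself witnesses that [phi] is in V. So H
    is exactly the set of x_phi with [phi] in V, and V determines H. *)
Lemma pattern_group_mx H (g : {'GL_n.+1[F]}) :
    H \subset pattern_group F J -> g \in H ->
  exists2 phi, phi \in pattern_functions (J := J) H
             & GLval g = 1 + pattern_mx phi.
Proof.
move=> H_sub gH; move: (subsetP H_sub g gH); rewrite inE.
case/imsetP => _ /imsetP[phi _ ->] def_g.
by exists phi => //; apply/pattern_functionsP; exists g.
Qed.

Lemma pattern_mx_closedM H phi psi :
    H \subset pattern_group F J -> submod_closed (pattern_functions (J := J) H) ->
    phi \in pattern_functions (J := J) H ->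
    psi \in pattern_functions (J := J) H ->
  exists2 chi, chi \in pattern_functions (J := J) H
             & pattern_mx phi * pattern_mx psi = pattern_mx chi.
Proof.
move=> H_sub [_ V_lin] phiV psiV.
have [g gH def_g] := pattern_functionsP _ _ phiV.
have [h hH def_h] := pattern_functionsP _ _ psiV.
have [chi chiV def_chi] := pattern_group_mx H_sub (groupM gH hH).
(* The witness is chi - phi - psi, nested so that each layer has the shape [a *: u + v] of the
   linearity half of [submod_closed] and of [pattern_mx_is_linear]. *)
exists ((-1) *: psi + ((-1) *: phi + chi)); first by apply: (V_lin) => //; apply: (V_lin).
have : (1 + pattern_mx phi) * (1 + pattern_mx psi) = 1 + pattern_mx chi.
  by rewrite def_g def_h -def_chi.
rewrite mulrDl mul1r mulrDr mulr1 -addrA => /addrI def_XY.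
rewrite !pattern_mx_is_linear !scaleN1r -def_XY.
(* With X = X_phi and Y = X_psi, the right-hand side is -Y + (-X + (Y + (X + XY))). Swapping Y and X
   puts each term next to its opposite. *)
by rewrite (addrCA (pattern_mx psi)) !addKr.
Qed.

End PatternMatrices.

Theorem proposition2p2 (F : finFieldType) (n : nat)
    (J : {set 'I_n.+1 * 'I_n.+1})
    (J_upper : strictly_upper J) (J_closed : closed_pattern J)
    (H : {group {'GL_n.+1[F]}}) (H_sub : H \subset pattern_group F J) :
  submod_closed (pattern_functions (J := J) H) <-> subalgebra_group J H.
Proof.
split=> [V_submod | [m [_ [m0 m_lin] _] defH]].
  have [V0 V_lin] := V_submod.
  exists [set pattern_mx phi | phi in pattern_functions (J := J) H].
    split; [|split|].
    - by apply/subsetP => _ /imsetP[phi _ ->]; apply: imset_f.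
    - by apply/imsetP; exists 0; rewrite ?pattern_mx0.
    - move=> a _ _ /imsetP[phi phiV ->] /imsetP[psi psiV ->].
      by rewrite -pattern_mx_is_linear imset_f ?V_lin.
    - move=> _ _ /imsetP[phi phiV ->] /imsetP[psi psiV ->].
      have [chi chiV ->] := pattern_mx_closedM H_sub V_submod phiV psiV.
      exact: imset_f.
  (* It remains to see that H = 1 + m: one inclusion needs H inside U_J, the other is the definition
     of V. *)
  apply/setP => A; apply/imsetP/imsetP => [[g gH ->] | [_ /imsetP[phi phiV ->] ->]].
    have [phi phiV ->] := pattern_group_mx H_sub gH.
    by exists (pattern_mx phi); rewrite ?imset_f.
  exact/pattern_functionsP.
(* Since X |-> 1 + X is injective, x_phi lies in 1 + m only if X_phi lies in m. Thus V is the
   preimage of m under the linear map phi |-> X_phi, and linearity of m pulls back to V. *)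
have memV phi : (phi \in pattern_functions (J := J) H) = (pattern_mx phi \in m).
  by rewrite inE defH; apply: (mem_imset _ _ (addrI 1)).
split=> [|a phi psi]; rewrite !memV ?pattern_mx0 //.
by rewrite pattern_mx_is_linear; apply: m_lin.
Qed.
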